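(* Let $A$ and $B:=A+uv^T$ be nonsingular $n\times n$ real matrices, with $u,v\in\mathbb{R}^n$, and let $b\in\mathbb{R}^n$. Suppose the linear system $Bx=b$ is solved using the Sherman–Morrison (SM) formula in floating-point arithmetic followed by one step of fixed-precision iterative refinement (SM-IR), where $y$, $z$ and $y_r$ are computed with a backward stable algorithm. Assume that the computed SM solution $\hat x$ satisfies $$|b-A\hat x-(v^T\hat x)u|\le\epsilon_M\big(g(A,u,v)|\hat x|+h(A,u,v,b)\big)$$ (the SM solver satisfying the corresponding bound when applied with right-hand side $\hat r$ in the refinement step), and that the computed residual $\hat r$ of $r=b-A\hat x-(v^T\hat x)u$ satisfies $$|r-\hat r|\le\epsilon_M\,t(A,u,v,\hat x,b).$$ Then the corrected solution $\hat w$ satisfies $$|b-A\hat w-(v^T\hat w)u|\le\epsilon_M\Big(h(A,u,v,\hat r)+t(A,u,v,\hat w,b)+\big(|A|+|u||v|^T\big)|\hat w|\Big)+\epsilon_M\,q,$$ where $q=\mathcal{O}(\epsilon_M)$ if $t(A,u,v,\hat x,b)-t(A,u,v,\hat w,b)=\mathcal{O}(\|\hat x-\hat w\|_\infty)$.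
   Context: Absolute values and inequalities of vectors and matrices are entrywise. $\epsilon_M$ is the unit roundoff, $\gamma_k=\frac{k\epsilon_M}{1-k\epsilon_M}$ (with $k\epsilon_M<1$), $e$ is the all-ones vector, $I$ the identity; hats denote quantities computed in floating-point arithmetic (standard model, one fixed precision). $\mathcal{O}(\cdot)$ is understood as $\epsilon_M\to0$. SM formula for $(A+uv^T)x=b$: (1) solve $Ay=b$; (2) solve $Az=u$; (3) $\alpha=v^Ty$, $\beta=1+v^Tz$, $\theta=\alpha/\beta$; (4) output $x=y-\theta z$; computed quantities are $\hat y,\hat z,\hat\alpha,\hat\beta,\hat\theta,\hat x$. One step of SM-IR: compute $\hat x$ by SM; compute the residual $r=b-A\hat x-(v^T\hat x)u$ in floating point, giving $\hat r$; solve $(A+uv^T)\delta x=\hat r$ by SM, i.e. solve $Ay_r=\hat r$, set $\alpha_r=v^Ty_r$, $\theta_r=\alpha_r/\beta$ (same $\beta$ and $z$ as before), $\delta x=y_r-\theta_rz$; output $\hat w$, the computed value of $\hat x+\delta x$. The computed $\alpha_r$ is $\hat\alpha_r$. The functions are $$g(A,u,v)=(c\,n^2ee^T+I)|A|+(n+1)|u||v|^T,$$ $$h(A,u,v,b)=\frac{|\hat\alpha|}{|\hat\beta|}\Big((2d\,n^2ee^T+3I)|A|+2(n+4)|u||v|^T\Big)|A^{-1}u|+2\frac{|\hat\alpha|}{|\hat\beta|}|u|,$$ with $c,d$ small integer constants, and $h(A,u,v,\hat r)$ is the same expression with $\hat\alpha$ replaced by $\hat\alpha_r$ (the quantity belonging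 to right-hand side $\hat r$). Also $$t(A,u,v,w,b)=\frac{\gamma_{n+2}}{\epsilon_M}\Big(|b|+(|A|+|u||v|^T)|w|\Big)\qquad(w\in\mathbb{R}^n).$$ *)

(* Defs.v *)
From HB Require Import structures.
From mathcomp Require Import all_boot all_order all_algebra.
From mathcomp Require Import all_classical all_reals all_analysis.
Import Order.TTheory GRing.Theory Num.Theory numFieldNormedType.Exports.

Set Implicit Arguments.
Unset Strict Implicit.
Unset Printing Implicit Defensive.

Local Open Scope ring_scope.

Definition mxabs (R : realType) (m n : nat) (M : 'M[R]_(m, n)) : 'M[R]_(m, n) :=
  map_mx (fun a : R => `|a|) M.

Definition mxle (R : realType) (m n : nat) (M N : 'M[R]_(m, n)) : Prop :=
  forall i j, M i j <= N i j.

Definition dotv (R : realType) (n : nat) (x y : 'cV[R]_n) : R :=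
  (x^T *m y) 0 0.

Definition gamma (R : realType) (eps : R) (k : nat) : R :=
  k%:R * eps / (1 - k%:R * eps).

(* Standard model of floating-point arithmetic with unit roundoff eps:
   xh is a possible computed value of an elementary operation whose exact
   result is x. *)
Definition fl (R : realType) (eps x xh : R) : Prop :=
  exists2 delta : R, `|delta| <= eps & xh = x * (1 + delta).

(* s is a possible computed value of the sum of a nonempty list, in some order
   and with some bracketing. There is no rule for the empty list: it would
   allow unboundedly many roundings through additions of an empty sum. *)
Inductive fl_sum (R : realType) (eps : R) : seq R -> R -> Prop :=
| fl_sum1 x : fl_sum eps [:: x] x
| fl_sum_cat l1 l2 s1 s2 s :
    fl_sum eps l1 s1 -> fl_sum eps l2 s2 -> fl eps (s1 + s2) s ->
    fl_sum eps (l1 ++ l2) s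
| fl_sum_perm l1 l2 s : perm_eq l1 l2 -> fl_sum eps l1 s -> fl_sum eps l2 s.

Definition fl_dot (R : realType) (n : nat) (eps : R) (x y : 'cV[R]_n) (s : R)
    : Prop :=
  exists2 p : 'I_n -> R,
    forall i, fl eps (x i 0 * y i 0) (p i) & fl_sum eps [seq p i | i : 'I_n] s.

(* y solves A y = rhs with normwise backward error at most K * eps. The norm is
   the max-entry norm; K is an arbitrary constant independent of eps, so the
   choice of norm is immaterial. *)
Definition backward_stable_solution (R : realType) (n : nat) (K eps : R)
    (A : 'M[R]_n) (rhs y : 'cV[R]_n) : Prop :=
  exists (E : 'M[R]_n) (f : 'cV[R]_n),
    [/\ (A + E) *m y = rhs + f,
        `|E| <= K * eps * `|A| & `|f| <= K * eps * `|rhs|].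

Definition residual (R : realType) (n : nat) (A : 'M[R]_n) (u v b x : 'cV[R]_n)
    : 'cV[R]_n :=
  b - A *m x - dotv v x *: u.

(* Negations are exact in floating-point arithmetic, so the additions and
   subtractions, in whatever order they are performed, form one sum. *)
Definition fl_residual (R : realType) (n : nat) (eps : R)
    (A : 'M[R]_n) (u v b x r : 'cV[R]_n) : Prop :=
  exists2 s : R, fl_dot eps v x s &
    forall i, exists (p : 'I_n -> R) (m : R),
      [/\ forall j, fl eps (A i j * x j 0) (p j),
          fl eps (s * u i 0) m
        & fl_sum eps (b i 0 :: - m :: [seq - p j | j : 'I_n]) (r i 0)].

(* The part of the Sherman-Morrison formula that does not involve the
   right-hand side: A z = u and beta = 1 + v^T z. *)
Definition fl_sm_setup (R : realType) (n : nat) (K eps : R)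
    (A : 'M[R]_n) (u v z : 'cV[R]_n) (beta : R) : Prop :=
  backward_stable_solution K eps A u z /\
  (exists2 s : R, fl_dot eps v z s & fl eps (1 + s) beta).

Definition fl_sm_solve (R : realType) (n : nat) (K eps : R)
    (A : 'M[R]_n) (v z : 'cV[R]_n) (beta : R)
    (rhs y : 'cV[R]_n) (alpha theta : R) (x : 'cV[R]_n) : Prop :=
  [/\ backward_stable_solution K eps A rhs y,
      fl_dot eps v y alpha,
      fl eps (alpha / beta) theta
    & forall i, exists2 p : R,
        fl eps (theta * z i 0) p & fl eps (y i 0 - p) (x i 0)].

(* All quantities computed during one run of SM-IR. *)
Record smir (R : realType) (n : nat) := Smir {
  zhat : 'cV[R]_n;
  betahat : R;
  yhat : 'cV[R]_n;
  alphahat : R;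
  thetahat : R;
  xhat : 'cV[R]_n;
  rhat : 'cV[R]_n;
  yrhat : 'cV[R]_n;
  alpharhat : R;
  thetarhat : R;
  dxhat : 'cV[R]_n;
  what : 'cV[R]_n
}.

Definition smir_run (R : realType) (n : nat) (K eps : R)
    (A : 'M[R]_n) (u v b : 'cV[R]_n) (s : smir R n) : Prop :=
  [/\ fl_sm_setup K eps A u v (zhat s) (betahat s),
      fl_sm_solve K eps A v (zhat s) (betahat s)
        b (yhat s) (alphahat s) (thetahat s) (xhat s),
      fl_residual eps A u v b (xhat s) (rhat s),
      fl_sm_solve K eps A v (zhat s) (betahat s)
        (rhat s) (yrhat s) (alpharhat s) (thetarhat s) (dxhat s)
    & forall i, fl eps (xhat s i 0 + dxhat s i 0) (what s i 0)].

Definition gfun (R : realType) (n c : nat) (A : 'M[R]_n) (u v : 'cV[R]_n)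
    : 'M[R]_n :=
  ((c * n ^ 2)%:R *: const_mx 1 + 1%:M) *m mxabs A
  + n.+1%:R *: (mxabs u *m (mxabs v)^T).

Definition hfun (R : realType) (n d : nat) (A : 'M[R]_n) (u v : 'cV[R]_n)
    (alpha beta : R) : 'cV[R]_n :=
  (`|alpha| / `|beta|) *:
    ((((2 * d * n ^ 2)%:R *: const_mx 1 + 3%:R *: 1%:M) *m mxabs A
      + (2 * (n + 4))%:R *: (mxabs u *m (mxabs v)^T))
     *m mxabs (invmx A *m u))
  + (2%:R * (`|alpha| / `|beta|)) *: mxabs u.

Definition tfun (R : realType) (n : nat) (eps : R) (A : 'M[R]_n)
    (u v w b : 'cV[R]_n) : 'cV[R]_n :=
  (gamma eps n.+2 / eps) *:
    (mxabs b + (mxabs A + mxabs u *m (mxabs v)^T) *m mxabs w).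

(* Main.v *)
Require Import Defs.
From HB Require Import structures.
From mathcomp Require Import all_boot all_order all_algebra.
From mathcomp Require Import all_classical all_reals all_analysis.
From mathcomp Require Import ring lra.
Import Order.TTheory GRing.Theory Num.Theory numFieldNormedType.Exports.

Local Open Scope ring_scope.
Local Open Scope classical_set_scope.

(* Write B = A + u v^T and w = (x + dx) + f, where |f| <= eps/(1 - eps) |w|.
   Then b - B w = (r - rhat) + (rhat - B dx) - B f, and bounding the three terms
   entrywise gives the estimate with
     q = (t(x) - t(w)) + g |dx| + eps/(1 - eps) (|A| + |u||v|^T) |w|.
   It remains to see that dx = O(eps) and x, w = O(1). Backward stability and
   1 + v^T A^-1 u != 0 keep betahat away from 0, so that h = O(|rhs|) for an SM
   solve with right-hand side rhs; the assumed residual bound then gives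
   |x| = O(|rhs|) and residual O(eps |rhs|). With rhs = b this yields
   rhat = O(eps), and with rhs = rhat it yields dx = O(eps). *)

(** * Max-entry norm, inner products and residuals *)

Lemma mx_norm_leP {R : realType} {m n : nat} (M : 'M[R]_(m, n)) (c : R) :
  0 <= c -> reflect (forall i j, `|M i j| <= c) (`|M| <= c).
Proof.
move=> c_ge0; rewrite /Num.norm /= mx_normrE.
apply: (iffP (bigmax_leP _ _ _ _)) => [[_ H] i j|H]; first exact: (H (i, j)).
by split=> // -[i j] _; exact: H.
Qed.

Lemma mx_norm_entry {R : realType} {m n : nat} (M : 'M[R]_(m, n)) i j :
  `|M i j| <= `|M|.
Proof. by move: i j; apply/mx_norm_leP. Qed.

Lemma norm_mxabs {R : realType} {m n : nat} (M : 'M[R]_(m, n)) :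
  `|mxabs M| = `|M|.
Proof.
by rewrite /Num.norm /= !mx_normrE; apply: eq_bigr => -[i j] _; rewrite mxE /= normr_id.
Qed.

Lemma mxle_norm {R : realType} {m n : nat} (M N : 'M[R]_(m, n)) :
  mxle (mxabs M) N -> `|M| <= `|N|.
Proof.
move=> MN; apply/mx_norm_leP => // i j; move: (MN i j); rewrite mxE => /le_trans.
by apply; exact: le_trans (ler_norm _) (mx_norm_entry _ _ _).
Qed.

Lemma mx_norm_mul {R : realType} {m n p : nat} (M : 'M[R]_(m, n)) (N : 'M[R]_(n, p)) :
  `|M *m N| <= n%:R * `|M| * `|N|.
Proof.
apply/mx_norm_leP => [|i j]; first by rewrite !mulr_ge0.
rewrite mxE (le_trans (ler_norm_sum _ _ _))//.
rewrite -mulrA mulr_natl -[X in _ *+ X]card_ord -sumr_const ler_sum// => k _.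
by rewrite normrM ler_pM// mx_norm_entry.
Qed.

Lemma norm_dotv {R : realType} {n : nat} (x y : 'cV[R]_n) :
  `|dotv x y| <= n%:R * `|x| * `|y|.
Proof.
rewrite /dotv (le_trans (mx_norm_entry _ _ _))// (le_trans (mx_norm_mul _ _))//.
suff -> : `|x^T : 'M[R]_(1, n)| = `|x| by [].
apply/eqP; rewrite eq_le; apply/andP; split; apply/mx_norm_leP => // i j.
  by rewrite mxE mx_norm_entry.
by have := mx_norm_entry x^T j i; rewrite mxE.
Qed.

Lemma dotvE {R : realType} {n : nat} (x y : 'cV[R]_n) :
  dotv x y = \sum_i x i 0 * y i 0.
Proof. by rewrite /dotv mxE; apply: eq_bigr => i _; rewrite mxE. Qed.

Lemma residualE {R : realType} {n : nat} (A : 'M[R]_n) (u v b x : 'cV[R]_n) :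
  residual A u v b x = b - (A + u *m v^T) *m x.
Proof.
rewrite /residual mulmxDl opprD addrA -mulmxA; congr (_ - _).
by rewrite [v^T *m x]mx11_scalar mul_mx_scalar.
Qed.

(** * Rounding errors of elementary operations, sums and inner products *)

Lemma fl_err {R : realType} (eps x xh : R) :
  fl eps x xh -> `|xh - x| <= eps * `|x|.
Proof.
by case=> d d_le ->; rewrite mulrDr mulr1 addrC addKr normrM mulrC ler_wpM2r.
Qed.

Lemma fl_norm_le {R : realType} (eps x xh : R) :
  fl eps x xh -> eps <= 1 -> `|xh| <= 2 * `|x|.
Proof.
move=> /fl_err xh_err eps_le1; rewrite -[xh](subrK x) (le_trans (ler_normD _ _))//.
have : eps * `|x| <= 1 * `|x| by rewrite ler_wpM2r.
lra.
Qed.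

Lemma fl_sum_size_gt0 {R : realType} (eps : R) l s : fl_sum eps l s -> (0 < size l)%N.
Proof.
elim=> // [l1 l2 ? ? ? _ + _ _ _|l1 l2 ? perm12 _] //.
  by rewrite size_cat addn_gt0 => ->.
by rewrite (perm_size perm12).
Qed.

(** Induction on the bracketing. When two lists are merged, with [a] and [c] their powers of 3, the
    coefficient of [eps * N1] is [(a + 1) + a]: the new rounding plus the inherited error. Since
    neither list is empty, [a] and [c] are at least 3 and this is at most [c * a]; the same holds
    for [N2]. The exponential factor is harmless, being independent of [eps]. *)
Lemma fl_sum_err {R : realType} (eps : R) l s : 0 <= eps <= 1 -> fl_sum eps l s ->
  `|s - \sum_(x <- l) x| <= eps * 3 ^+ size l * \sum_(x <- l) `|x|.
Proof.
move=> /andP[eps_ge0 eps_le1]; elim.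
- by move=> x; rewrite !big_seq1 subrr normr0 !mulr_ge0.
- move=> l1 l2 s1 s2 t sum1 IH1 sum2 IH2 /fl_err Ht.
  rewrite !big_cat /= size_cat exprD.
  move: (fl_sum_size_gt0 _ _ _ sum1) (fl_sum_size_gt0 _ _ _ sum2) IH1 IH2.
  set S1 := \sum_(x <- l1) x; set S2 := \sum_(x <- l2) x.
  set N1 := \sum_(x <- l1) `|x|; set N2 := \sum_(x <- l2) `|x|.
  have N1_ge0 : 0 <= N1 by apply: sumr_ge0.
  have N2_ge0 : 0 <= N2 by apply: sumr_ge0.
  have S1_le : `|S1| <= N1 by apply: ler_norm_sum.
  have S2_le : `|S2| <= N2 by apply: ler_norm_sum.
  have ge3 k : (0 < k)%N -> 3 <= 3 ^+ k :> R.
    by case: k => // k _; rewrite exprS ler_peMr// exprn_ege1// ler1n.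
  move=> /ge3; set a := 3 ^+ size l1 => a3 /ge3; set c := 3 ^+ size l2 => c3 IH1 IH2.
  have s1_le : `|s1| <= a * N1 + N1.
    rewrite -[s1](subrK S1) (le_trans (ler_normD _ _))// lerD// (le_trans IH1)//.
    by rewrite -mulrA ler_piMl// mulr_ge0//; lra.
  have s2_le : `|s2| <= c * N2 + N2.
    rewrite -[s2](subrK S2) (le_trans (ler_normD _ _))// lerD// (le_trans IH2)//.
    by rewrite -mulrA ler_piMl// mulr_ge0//; lra.
  have -> : t - (S1 + S2) = (t - (s1 + s2)) + (s1 - S1) + (s2 - S2) by ring.
  apply: le_trans (_ : eps * (`|s1| + `|s2|) + eps * a * N1 + eps * c * N2 <= _).
    rewrite (le_trans (ler_normD _ _))// lerD// (le_trans (ler_normD _ _))// lerD//.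
    by rewrite (le_trans Ht)// ler_wpM2l// ler_normD.
  rewrite -!mulrA -!mulrDr ler_wpM2l//.
  have : 3 * a * N1 <= c * a * N1 by rewrite ler_wpM2r// ler_wpM2r//; lra.
  have : 3 * c * N2 <= a * c * N2 by rewrite ler_wpM2r// ler_wpM2r//; lra.
  have : 3 * N1 <= a * N1 by rewrite ler_wpM2r.
  have : 3 * N2 <= c * N2 by rewrite ler_wpM2r.
  lra.
- move=> l1 l2 ? perm12 _.
  by rewrite !(perm_big l2 perm12) (perm_size perm12).
Qed.

(** The summation error concerns rounded products, each at most twice the exact one in absolute
    value, whence [2 * 3 ^+ n]; rounding the products themselves adds 1. The factor [n] comes from
    bounding the sum of the exact products by norms. *)
Lemma fl_dot_err {R : realType} {n : nat} (eps : R) (x y : 'cV[R]_n) (s : R) :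
  0 <= eps <= 1 -> fl_dot eps x y s ->
  `|s - dotv x y| <= eps * ((2 * 3 ^+ n + 1) * n%:R) * (`|x| * `|y|).
Proof.
move=> eps01 [p p_fl /(fl_sum_err _ _ _ eps01)].
have /andP[eps_ge0 eps_le1] := eps01.
rewrite size_image card_ord !big_image /= => s_err.
have sum_le : \sum_i `|x i 0 * y i 0| <= n%:R * (`|x| * `|y|).
  rewrite mulr_natl -[X in _ *+ X]card_ord -sumr_const ler_sum// => k _.
  by rewrite normrM ler_pM// mx_norm_entry.
have p_le : \sum_i `|p i| <= 2 * \sum_i `|x i 0 * y i 0|.
  by rewrite mulr_sumr ler_sum// => i _; exact: fl_norm_le.
have p_err : `|\sum_i p i - dotv x y| <= eps * \sum_i `|x i 0 * y i 0|.
  rewrite dotvE -sumrB (le_trans (ler_norm_sum _ _ _))// mulr_sumr ler_sum// => i _.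
  exact: fl_err.
rewrite -(subrKA (\sum_i p i)) (le_trans (ler_normD _ _))//.
move: p_le p_err s_err sum_le.
set P := \sum_i `|p i|; set X := \sum_i `|x i 0 * y i 0| => p_le p_err s_err sum_le.
apply: le_trans (lerD s_err p_err) _; rewrite -!mulrA -mulrDr ler_wpM2l//.
have : 3 ^+ n * P <= 3 ^+ n * (2 * X) by rewrite ler_wpM2l// exprn_ge0.
have : (2 * 3 ^+ n + 1) * X <= (2 * 3 ^+ n + 1) * (n%:R * (`|x| * `|y|)).
  by rewrite ler_wpM2l// addr_ge0// mulr_ge0// exprn_ge0.
lra.
Qed.

(** * Bounds for an SM solve, uniform in small unit roundoff *)

Lemma near0_mul_le {R : realType} (c : R) : \forall e \near (0 : R), c * e <= 2^-1.
Proof.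
(* The bound 1/2 lets a term with coefficient [c * e] be absorbed into a left-hand side at the cost
   of a factor 2. The summand 1 keeps the divisor positive when [c] is 0. *)
have c1_gt0 : 0 < 2 * (`|c| + 1) by rewrite mulr_gt0// ltr_wpDl.
near=> e; have : `|e| <= 1 / (2 * (`|c| + 1)).
  by near: e; apply: (@nbhs0_le _ R^o); exact: divr_gt0.
rewrite ler_pdivlMr// => e_le.
have : c * e <= `|c| * `|e| by rewrite -normrM ler_norm.
have := normr_ge0 e; lra.
Unshelve. all: by end_near. Qed.

(** The error is $A^{-1}(f-Ey)$, which still contains the computed [y]. Bounding [y] by the exact
    solution plus the error gives an inequality with the error [D] on both sides; its coefficient
    [a * k * m * e] on the right is at most 1/2 for small [e], so it can be absorbed. *)
Lemma backward_stable_err {R : realType} {n : nat} (A : 'M[R]_n) (K : R) :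
  A \in unitmx ->
  exists2 C : R, 0 <= C & \forall e \near (0 : R), 0 < e ->
    forall rhs y, backward_stable_solution K e A rhs y ->
      `|y - invmx A *m rhs| <= C * e * `|rhs|.
Proof.
move=> unitA.
pose a := n%:R * `|invmx A|; pose k := `|K|; pose m := n%:R * `|A|.
have a_ge0 : 0 <= a by rewrite mulr_ge0.
have k_ge0 : 0 <= k := normr_ge0 K.
have m_ge0 : 0 <= m by rewrite mulr_ge0.
exists (2 * (a * k * (1 + m * a))); first by rewrite !(mulr_ge0, addr_ge0).
near=> e => e_gt0 rhs y [E [f [Ey E_le f_le]]].
have e_small : a * k * m * e <= 2^-1 by near: e; exact: near0_mul_le.
have Ke : K * e <= k * e by apply: ler_wpM2r; [exact: ltW | exact: ler_norm].
have {}f_le : `|f| <= k * e * `|rhs| by rewrite (le_trans f_le)// ler_wpM2r.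
have {}E_le : n%:R * `|E| <= k * e * m.
  by rewrite mulrCA ler_wpM2l// (le_trans E_le)// ler_wpM2r.
have -> : y - invmx A *m rhs = invmx A *m (f - E *m y).
  apply: (can_inj (mulKmx unitA)); rewrite mulmxBr !mulKVmx//.
  by apply/eqP; rewrite subr_eq addrAC [f + _]addrC -Ey mulmxDl addrK.
have dE := mx_norm_mul (invmx A) (f - E *m y); rewrite -/a in dE.
have y_le : `|y| <= a * `|rhs| + `|invmx A *m (f - E *m y)|.
  have yE : invmx A *m rhs + invmx A *m (f - E *m y) = y.
    by rewrite -mulmxDr addrA -Ey mulmxDl addrK mulKmx.
  by rewrite -{1}yE (le_trans (ler_normD _ _))// lerD ?mx_norm_mul.
move: dE y_le; set D := `|_ *m (_ - _)| => dE y_le.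
have fEy : `|f - E *m y| <= k * e * `|rhs| + k * e * m * `|y|.
  rewrite (le_trans (ler_normB _ _))// lerD// (le_trans (mx_norm_mul _ _))//.
  by rewrite ler_wpM2r.
have {}dE : D <= a * k * e * `|rhs| + a * k * m * e * `|y|.
  apply: le_trans dE _; apply: le_trans (ler_wpM2l a_ge0 fEy) _; lra.
have akme : 0 <= a * k * m * e by rewrite !mulr_ge0// ?ltW.
have : a * k * m * e * D <= 2^-1 * D by apply: ler_wpM2r => //; exact: normr_ge0.
have := ler_wpM2l akme y_le.
lra.
Unshelve. all: by end_near. Qed.

(** $(A+uv^T)A^{-1}u=(1+v^TA^{-1}u)u$. If the scalar vanished, $A^{-1}u$ would be 0 by
    nonsingularity of $A+uv^T$, and the scalar would be 1. *)
Lemma sherman_morrison_denom_neq0 {R : realType} {n : nat} (A : 'M[R]_n) (u v : 'cV[R]_n) :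
  A \in unitmx -> A + u *m v^T \in unitmx -> 1 + dotv v (invmx A *m u) != 0.
Proof.
move=> unitA unitB; apply/negP => /eqP den0.
have w0 : invmx A *m u = 0.
  apply: (can_inj (mulKmx unitB)); rewrite mulmx0 mulmxDl mulKVmx//.
  rewrite -mulmxA [v^T *m _]mx11_scalar mul_mx_scalar.
  by rewrite -[X in X + _]scale1r -scalerDl den0 scale0r.
by move/eqP: den0; rewrite w0 /dotv mulmx0 mxE addr0 oner_eq0.
Qed.

(** This controls the division by [beta] in [hfun]. Half of the exact denominator can be lost to the
    errors in [z] and in the inner product, and half of the rest to the final rounding, which
    explains the 4 in the witness. *)
Lemma sm_setup_beta_lower {R : realType} {n : nat} (A : 'M[R]_n) (u v : 'cV[R]_n) (K : R) :
  A \in unitmx -> A + u *m v^T \in unitmx ->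
  exists2 c : R, 0 < c & \forall e \near (0 : R), 0 < e ->
    forall z beta, fl_sm_setup K e A u v z beta -> c <= `|beta|.
Proof.
move=> unitA unitB.
have [C C_ge0 near_z] := backward_stable_err A K unitA.
have den_neq0 := sherman_morrison_denom_neq0 A u v unitA unitB.
set w := invmx A *m u in den_neq0 *.
pose D := (2 * 3 ^+ n + 1) * n%:R : R.
have D_ge0 : 0 <= D by rewrite mulr_ge0// addr_ge0// mulr_ge0// exprn_ge0.
(* The first summand accounts for rounding in the inner product, the second for the error of [z] as
   a solution of $Az=u$. *)
pose L := D * (`|v| * (`|w| + C * `|u|)) + n%:R * `|v| * (C * `|u|).
have den_gt0 : 0 < `|1 + dotv v w| by rewrite normr_gt0.
exists (`|1 + dotv v w| / 4); first by rewrite divr_gt0.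
near=> e => e_gt0 z beta [z_sol [s s_dot /fl_err beta_err]].
have e_le : 1 * e <= 2^-1 by near: e; exact: near0_mul_le.
have e01 : 0 <= e <= 1 by apply/andP; split; lra.
have Le : (L / `|1 + dotv v w|) * e <= 2^-1 by near: e; exact: near0_mul_le.
have {}Le : L * e <= `|1 + dotv v w| / 2.
  by move: Le; rewrite mulrAC ler_pdivrMr// [2^-1 * _]mulrC.
have z_err : `|z - w| <= C * e * `|u|.
  by apply: (near near_z e).
have z_le : `|z| <= `|w| + C * `|u|.
  rewrite -[z](subrK w) [leRHS]addrC (le_trans (ler_normD _ _))// lerD2r.
  by rewrite (le_trans z_err)// ler_wpM2r// ler_piMr//; case/andP: e01.
have s_err : `|s - dotv v w| <= L * e.
  rewrite -(subrKA (dotv v z)) (le_trans (ler_normD _ _))// /L mulrDl lerD//.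
    rewrite (le_trans (fl_dot_err _ _ _ _ e01 s_dot))// -/D.
    have : `|v| * `|z| <= `|v| * (`|w| + C * `|u|) by rewrite ler_wpM2l.
    move/(ler_wpM2l (mulr_ge0 (ltW e_gt0) D_ge0)); lra.
  have -> : dotv v z - dotv v w = dotv v (z - w).
    by rewrite /dotv mulmxBr !mxE.
  rewrite (le_trans (norm_dotv _ _))//.
  have := ler_wpM2l (mulr_ge0 (ler0n R n) (normr_ge0 v)) z_err; lra.
have : `|1 + dotv v w| <= `|1 + s| + `|s - dotv v w|.
  have -> : 1 + dotv v w = (1 + s) - (s - dotv v w) by ring.
  exact: ler_normB.
have : `|1 + s| <= `|beta| + `|beta - (1 + s)|.
  by have := ler_normB beta (beta - (1 + s)); rewrite opprB addrC subrK.
have : e * `|1 + s| <= 2^-1 * `|1 + s| by rewrite ler_wpM2r//; lra.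
lra.
Unshelve. all: by end_near. Qed.

(** Proportionality to [rhs] is what allows one constant to serve both the solve for [b] and the
    solve for the small right-hand side [rhat]. The assumed bound has [x] on its right through
    [gfun]; writing [x] as $(A+uv^T)^{-1}$ applied to [rhs] minus the residual, that contribution
    has coefficient [b * G * e], at most 1/2, and is absorbed. *)
Lemma sm_solve_bound {R : realType} {n : nat} (c d : nat) (K : R)
    (A : 'M[R]_n) (u v : 'cV[R]_n) :
  A \in unitmx -> A + u *m v^T \in unitmx ->
  exists2 C : R, 0 <= C & \forall e \near (0 : R), 0 < e ->
    forall z beta rhs y alpha theta x, fl_sm_setup K e A u v z beta ->
      fl_sm_solve K e A v z beta rhs y alpha theta x ->
      mxle (mxabs (residual A u v rhs x))
        (e *: (gfun c A u v *m mxabs x + hfun d A u v alpha beta)) ->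
      `|x| <= C * `|rhs| /\ `|residual A u v rhs x| <= C * e * `|rhs|.
Proof.
move=> unitA unitB.
have [C0 C0_ge0 near_y] := backward_stable_err A K unitA.
have [m m_gt0 near_beta] := sm_setup_beta_lower A u v K unitA unitB.
pose Y := n%:R * `|invmx A| + C0.
pose W := (n%:R + (2 * 3 ^+ n + 1) * n%:R) * `|v| : R.
pose H := `|hfun d A u v 1 1|.
pose P := H * (W * Y / m).
pose G := n%:R * `|gfun c A u v|.
pose b := n%:R * `|invmx (A + u *m v^T)|.
pose X := 2 * (b * (1 + P)).
have D_ge0 : 0 <= (2 * 3 ^+ n + 1) * n%:R :> R.
  by rewrite mulr_ge0// addr_ge0// mulr_ge0// exprn_ge0.
have Y_ge0 : 0 <= Y by rewrite addr_ge0// mulr_ge0.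
have W_ge0 : 0 <= W by rewrite mulr_ge0// addr_ge0.
have H_ge0 : 0 <= H by apply: normr_ge0.
have P_ge0 : 0 <= P by rewrite mulr_ge0// divr_ge0 ?mulr_ge0// ltW.
have G_ge0 : 0 <= G by rewrite mulr_ge0.
have b_ge0 : 0 <= b by rewrite mulr_ge0.
have X_ge0 : 0 <= X by rewrite !mulr_ge0// addr_ge0.
(* [X] bounds the solution and [G * X + P] the residual divided by [e]; the sum serves for both. *)
exists (X + (G * X + P)).
  exact: addr_ge0 X_ge0 (addr_ge0 (mulr_ge0 G_ge0 X_ge0) P_ge0).
near=> e => e_gt0 z beta rhs y alpha theta x setup [y_sol alpha_dot _ _] /mxle_norm.
have e_le : 1 * e <= 2^-1 by near: e; exact: near0_mul_le.
have e01 : 0 <= e <= 1 by apply/andP; split; lra.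
have bGe : b * G * e <= 2^-1 by near: e; exact: near0_mul_le.
have m_le : m <= `|beta| by apply: (near near_beta e) setup.
have y_err : `|y - invmx A *m rhs| <= C0 * e * `|rhs| by apply: (near near_y e).
have beta_gt0 : 0 < `|beta| := lt_le_trans m_gt0 m_le.
have y_le : `|y| <= Y * `|rhs|.
  rewrite -[y](subrK (invmx A *m rhs)) /Y [_ + C0]addrC mulrDl.
  rewrite (le_trans (ler_normD _ _))// lerD ?mx_norm_mul//.
  rewrite (le_trans y_err)// ler_wpM2r// ler_piMr//.
  by case/andP: e01.
have alpha_le : `|alpha| <= W * `|y|.
  rewrite -[alpha](subrK (dotv v y)) (le_trans (ler_normD _ _))//.
  have := norm_dotv v y.
  have := fl_dot_err _ _ _ _ e01 alpha_dot.
  set D := _ * n%:R in D_ge0 *.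
  have : e * D * (`|v| * `|y|) <= 1 * D * (`|v| * `|y|).
    by rewrite ler_wpM2r ?mulr_ge0// ler_wpM2r//; lra.
  rewrite /W -/D; lra.
have h_le : `|hfun d A u v alpha beta| <= P * `|rhs|.
  (* [hfun] depends on [alpha] and [beta] only through a scalar factor, so its size reduces to the
     fixed norm [H] and the ratio, where [alpha] is at most [W * Y] times the norm of [rhs] and
     [beta] at least [m]. *)
  have -> : hfun d A u v alpha beta = (`|alpha| / `|beta|) *: hfun d A u v 1 1.
    by rewrite /hfun normr1 divr1 mulr1 scale1r scalerDr scalerA [_ * 2]mulrC.
  rewrite normrZ -/H ger0_norm ?divr_ge0// mulrC /P -mulrA ler_wpM2l//.
  rewrite ler_pdivrMr//.
  have WYr : `|alpha| <= W * Y * `|rhs|.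
    by rewrite (le_trans alpha_le)// -mulrA ler_wpM2l.
  have : W * Y * `|rhs| / m * m <= W * Y * `|rhs| / m * `|beta|.
    by rewrite ler_wpM2l// divr_ge0 ?(ltW m_gt0)// !mulr_ge0.
  rewrite divfK ?gt_eqF//; lra.
rewrite normrZ gtr0_norm// => res_le.
have {}res_le : `|residual A u v rhs x| <= e * (G * `|x| + P * `|rhs|).
  rewrite (le_trans res_le)// ler_wpM2l ?(ltW e_gt0)// (le_trans (ler_normD _ _))// lerD//.
  by rewrite (le_trans (mx_norm_mul _ _))// norm_mxabs.
have x_le : `|x| <= X * `|rhs|.
  have : `|x| <= b * (`|rhs| + `|residual A u v rhs x|).
    have {1}-> : x = invmx (A + u *m v^T) *m (rhs - residual A u v rhs x).
      by rewrite residualE subKr mulKmx.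
    by rewrite (le_trans (mx_norm_mul _ _))// ler_wpM2l// ler_normB.
  have : b * G * e * `|x| <= 2^-1 * `|x| by rewrite ler_wpM2r.
  have := ler_wpM2l b_ge0 res_le.
  have : b * P * e * `|rhs| <= b * P * 1 * `|rhs|.
    by apply: ler_wpM2r => //; apply: ler_wpM2l; [exact: mulr_ge0 | lra].
  rewrite /X; lra.
split.
  by rewrite (le_trans x_le)// ler_wpM2r// lerDl addr_ge0// mulr_ge0.
apply: le_trans res_le _.
have := ler_wpM2l G_ge0 x_le.
move/(ler_wpM2l (ltW e_gt0)).
have : 0 <= X * e * `|rhs| := mulr_ge0 (mulr_ge0 X_ge0 (ltW e_gt0)) (normr_ge0 rhs).
lra.
Unshelve. all: by end_near. Qed.

(** * Estimates for the update and for the function $t$ *)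

Lemma fl_err_computed {R : realType} (eps x xh : R) : 0 <= eps < 1 ->
  fl eps x xh -> `|xh - x| <= eps / (1 - eps) * `|xh|.
Proof.
move=> /andP[eps_ge0 eps_lt1] /fl_err xh_err.
rewrite mulrAC ler_pdivlMr ?subr_gt0//.
(* Passing from the exact to the computed value is what brings in [1 - eps]; the final estimate is
   in terms of the computed [what], so the error must be relative to it. *)
have : `|x| <= `|xh| + `|xh - x| by rewrite -{1}[x](subKr xh) ler_normB.
move/(ler_wpM2l eps_ge0); lra.
Qed.

Lemma mxabs_mul_le {R : realType} {m n p : nat} (M N : 'M[R]_(m, n)) (x y : 'M[R]_(n, p)) :
  mxle (mxabs M) N -> mxle (mxabs x) y -> mxle (mxabs (M *m x)) (N *m y).
Proof.
move=> MN xy i j; rewrite !mxE (le_trans (ler_norm_sum _ _ _))// ler_sum// => k _.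
move: (MN i k) (xy k j); rewrite !mxE normrM => MN_le xy_le.
exact: ler_pM.
Qed.

(** The factor $\gamma_{n+2}/\epsilon_M$ equals $(n+2)/(1-(n+2)\epsilon_M)$, hence stays below
    $2(n+2)$ once the denominator is at least 1/2. *)
Lemma norm_tfun_le {R : realType} {n : nat} (eps : R) (A : 'M[R]_n) (u v w b : 'cV[R]_n) :
  0 < eps -> n.+2%:R * eps <= 2^-1 ->
  `|tfun eps A u v w b| <=
    2 * n.+2%:R * (`|b| + n%:R * `|mxabs A + mxabs u *m (mxabs v)^T| * `|w|).
Proof.
move=> eps_gt0 eps_small.
have den_gt0 : 0 < 1 - n.+2%:R * eps by lra.
rewrite /tfun.
have -> : gamma eps n.+2 / eps = n.+2%:R / (1 - n.+2%:R * eps).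
  by rewrite /gamma mulrAC mulfK ?gt_eqF.
rewrite normrZ ger0_norm ?divr_ge0 ?(ltW den_gt0)// ler_pM ?divr_ge0 ?(ltW den_gt0)//.
  rewrite ler_pdivrMr//.
  have : 0 <= n.+2%:R :> R by [].
  move: den_gt0 eps_small; set N := n.+2%:R => den_gt0 eps_small N_ge0.
  have : N * (N * eps) <= N * 2^-1 by rewrite ler_wpM2l.
  lra.
rewrite (le_trans (ler_normD _ _))// lerD ?norm_mxabs//.
by rewrite (le_trans (mx_norm_mul _ _))// norm_mxabs.
Qed.

Lemma mxle_abs_addB {R : realType} {m n : nat} (M1 M2 M3 N1 N2 N3 : 'M[R]_(m, n)) :
  mxle (mxabs M1) N1 -> mxle (mxabs M2) N2 -> mxle (mxabs M3) N3 ->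
  mxle (mxabs (M1 + M2 - M3)) (N1 + N2 + N3).
Proof.
move=> MN1 MN2 MN3 i j; move: (MN1 i j) (MN2 i j) (MN3 i j); rewrite !mxE => le1 le2 le3.
by rewrite (le_trans (ler_normB _ _))// lerD// (le_trans (ler_normD _ _))// lerD.
Qed.

(* The data A, u, v, b are fixed; run i is an execution of SM-IR with unit
   roundoff eps i, and eps tends to 0 along the filter F, which is the limit
   process to which the O-terms refer. The norm on 'cV[R]_n is the max norm. *)
Theorem theorem4p6 (R : realType) (n c d : nat) (K : R)
    (A : 'M[R]_n) (u v b : 'cV[R]_n)
    (T : Type) (F : filter_on T)
    (eps : T -> R) (run : T -> smir R n)
    (unitA : A \in unitmx) (unitB : A + u *m v^T \in unitmx)
    (eps_gt0 : forall i, 0 < eps i)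
    (eps_lt1 : forall i, n.+2%:R * eps i < 1)
    (eps_to0 : eps @ F --> (0 : R))
    (Hrun : forall i, smir_run K (eps i) A u v b (run i))
    (Hx : forall i,
       mxle (mxabs (residual A u v b (xhat (run i))))
         (eps i *: (gfun c A u v *m mxabs (xhat (run i))
                    + hfun d A u v (alphahat (run i)) (betahat (run i)))))
    (Hdx : forall i,
       mxle (mxabs (residual A u v (rhat (run i)) (dxhat (run i))))
         (eps i *: (gfun c A u v *m mxabs (dxhat (run i))
                    + hfun d A u v (alpharhat (run i)) (betahat (run i)))))
    (Hr : forall i,
       mxle (mxabs (residual A u v b (xhat (run i)) - rhat (run i)))
         (eps i *: tfun (eps i) A u v (xhat (run i)) b)) :
  exists q : T -> 'cV[R]_n,
    (forall i,
       mxle (mxabs (residual A u v b (what (run i))))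
         (eps i *: (hfun d A u v (alpharhat (run i)) (betahat (run i))
                    + tfun (eps i) A u v (what (run i)) b
                    + (mxabs A + mxabs u *m (mxabs v)^T)
                        *m mxabs (what (run i)))
          + eps i *: q i)) /\
    ((fun i => tfun (eps i) A u v (xhat (run i)) b
               - tfun (eps i) A u v (what (run i)) b)
       =O_F (fun i => xhat (run i) - what (run i)) ->
     q =O_F (eps : T -> R^o)).
Proof.
pose S := mxabs A + mxabs u *m (mxabs v)^T.
pose e1 (i : T) := eps i / (1 - eps i).
pose q (i : T) :=
  (tfun (eps i) A u v (xhat (run i)) b - tfun (eps i) A u v (what (run i)) b)
  + gfun c A u v *m mxabs (dxhat (run i)) + e1 i *: (S *m mxabs (what (run i))).
have eps01 i : 0 <= eps i < 1.
  rewrite ltW//= (le_lt_trans _ (eps_lt1 i))// ler_peMl ?(ltW (eps_gt0 i))//.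
  by rewrite ler1n.
exists q; split=> [i|].

  (* The entrywise residual bound *)
  have [_ _ _ _ what_fl] := Hrun i.
  move: (Hdx i) (Hr i) what_fl; rewrite /q /e1.
  set x := xhat _; set w := what _; set dx := dxhat _; set r := rhat _.
  set h := hfun _ _ _ _ _ _; set tx := tfun _ _ _ _ x _; set tw := tfun _ _ _ _ w _.
  move=> dx_res r_err w_fl.
  have f_le : mxle (mxabs (w - (x + dx))) ((eps i / (1 - eps i)) *: mxabs w).
    by move=> j k; rewrite (ord1 k) !mxE; have := fl_err_computed _ _ _ (eps01 i) (w_fl j).
  have B_le : mxle (mxabs (A + u *m v^T)) S.
    move=> j k; rewrite !mxE (le_trans (ler_normD _ _))// lerD//.
    by rewrite !big_ord1 !mxE normrM.
  have Bf_le := mxabs_mul_le _ _ _ _ B_le f_le.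
  have -> : residual A u v b w = (residual A u v b x - r) + residual A u v r dx
      - (A + u *m v^T) *m (w - (x + dx)).
    rewrite !residualE mulmxBr mulmxDr.
    by apply/matrixP => j k; rewrite !mxE; ring.
  (* The summand [eps i] produces the term $(|A|+|u||v|^T)|\hat w|$ of the claim; the second-order
     summand goes into [q]. *)
  have e1E : eps i / (1 - eps i) = eps i + eps i * (eps i / (1 - eps i)).
    have /andP[_ e_lt1] := eps01 i.
    by field; rewrite subr_eq0 gt_eqF.
  (* The two occurrences of [tw] cancel, leaving exactly the sum of the bounds for the three terms
     of the residual. *)
  have -> : eps i *: (h + tw + S *m mxabs w)
      + eps i *: (tx - tw + gfun c A u v *m mxabs dx
                  + (eps i / (1 - eps i)) *: (S *m mxabs w))
    = eps i *: tx + eps i *: (gfun c A u v *m mxabs dx + h)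
      + S *m ((eps i / (1 - eps i)) *: mxabs w).
    rewrite -scalemxAr; move: (S *m _) (_ *m mxabs dx) (h) (tx) (tw) => s1 s2 s3 s4 s5.
    rewrite {2}e1E scalerDl -scalerA !scalerDr scalerN.
    by apply/matrixP => j k; rewrite !mxE; ring.
  exact: mxle_abs_addB.

(* The remainder [q] is of order [eps] *)
move=> /eqO_exP[k k_gt0 near_t]; apply/eqO_exP.
have [C C_ge0 near_sm] := sm_solve_bound c d K A u v unitA unitB.
pose N := 2 * n.+2%:R : R.
pose M := n%:R * `|S|.
(* [Q] bounds [rhat] divided by [eps]: the exact residual contributes the first summand, the bound
   on $t$ at [xhat] the second. [W] bounds [what], its factor 2 covering the rounded addition, and
   [V] bounds [xhat - what] divided by [eps]. *)
pose Q := C * `|b| + N * (`|b| + M * (C * `|b|)).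
pose W := 2 * (C * `|b| + C * Q).
pose V := C * Q + C * `|b| + C * Q.
have N_ge0 : 0 <= N by rewrite mulr_ge0.
have M_ge0 : 0 <= M by rewrite mulr_ge0.
have Cb_ge0 : 0 <= C * `|b| by rewrite mulr_ge0.
have Q_ge0 : 0 <= Q by rewrite addr_ge0// mulr_ge0// addr_ge0// mulr_ge0.
have CQ_ge0 : 0 <= C * Q by rewrite mulr_ge0.
pose G := n%:R * `|gfun c A u v|.
have G_ge0 : 0 <= G by rewrite mulr_ge0.
(* One summand for each of the three terms of [q]; the final 1 makes the constant strictly
   positive. *)
exists (k * V + G * (C * Q) + 2 * (M * W) + 1).
  by rewrite ltr_wpDl// addr_ge0 ?addr_ge0 ?mulr_ge0 ?(ltW k_gt0)// /V /W addr_ge0// addr_ge0.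
have near_eps (P : R -> Prop) :
    (\forall e \near (0 : R), P e) -> \forall j \near F, P (eps j).
  by move=> nearP; exact: eps_to0.
have {}near_sm := near_eps _ near_sm.
have small a := near_eps _ (near0_mul_le a).
near=> i.
have [setup sol_x _ sol_dx what_fl] := Hrun i.
have e_gt0 := eps_gt0 i.
have e_small : 1 * eps i <= 2^-1 by near: i; exact: small.
have ne_small : n.+2%:R * eps i <= 2^-1 by near: i; exact: small.
have t_le : `|tfun (eps i) A u v (xhat (run i)) b
    - tfun (eps i) A u v (what (run i)) b|
    <= k * `|xhat (run i) - what (run i)| by near: i.
move: (Hdx i) (Hr i) (Hx i) setup sol_x sol_dx what_fl t_le; rewrite /q /e1.
set x := xhat _; set w := what _; set dx := dxhat _; set r := rhat _.
move=> dx_res r_err x_res setup sol_x sol_dx w_fl t_le.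
have [x_le resx_le] : `|x| <= C * `|b| /\ `|residual A u v b x| <= C * eps i * `|b|.
  by apply: (near near_sm i) setup sol_x x_res.
have [dx_le _] : `|dx| <= C * `|r| /\ `|residual A u v r dx| <= C * eps i * `|r|.
  by apply: (near near_sm i) setup sol_dx dx_res.
have r_le : `|r| <= Q * eps i.
  have -> : r = residual A u v b x - (residual A u v b x - r) by rewrite subKr.
  rewrite (le_trans (ler_normB _ _))// /Q mulrDl lerD//.
    by rewrite mulrAC.
  rewrite (le_trans (mxle_norm _ _ r_err))// normrZ gtr0_norm// mulrC.
  rewrite ler_wpM2r ?(ltW e_gt0)//.
  rewrite (le_trans (norm_tfun_le _ _ _ _ _ _ e_gt0 ne_small))// ler_wpM2l//.
  by rewrite lerD2l ler_wpM2l.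
have {}dx_le : `|dx| <= C * Q * eps i.
  by rewrite (le_trans dx_le)// -mulrA ler_wpM2l.
have xdx_le : `|x| + `|dx| <= C * `|b| + C * Q.
  rewrite lerD// (le_trans dx_le)// ler_piMr//; lra.
have w_le : `|w| <= W.
  apply/mx_norm_leP => [|j l]; first by rewrite mulr_ge0// addr_ge0.
  rewrite (ord1 l) (le_trans (fl_norm_le _ _ _ (w_fl j) _))//; first by lra.
  rewrite ler_wpM2l// (le_trans (ler_normD _ _))// (le_trans _ xdx_le)//.
  by rewrite lerD// mx_norm_entry.
have xw_le : `|x - w| <= V * eps i.
  apply/mx_norm_leP => [|j l]; first by rewrite mulr_ge0 ?(ltW e_gt0)// !addr_ge0.
  rewrite (ord1 l) !mxE.
  (* The difference consists of the rounding error of the update and the correction [dx], both of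
     order [eps]. *)
  have -> : x j 0 - w j 0 = - (w j 0 - (x j 0 + dx j 0)) - dx j 0 by ring.
  rewrite (le_trans (ler_normB _ _))// normrN.
  have := fl_err _ _ _ (w_fl j).
  have : eps i * `|x j 0 + dx j 0| <= eps i * (C * `|b| + C * Q).
    rewrite ler_wpM2l ?(ltW e_gt0)// (le_trans (ler_normD _ _))// (le_trans _ xdx_le)//.
    by rewrite lerD// mx_norm_entry.
  have := le_trans (mx_norm_entry dx j 0) dx_le.
  rewrite /V; lra.
have e1_le : eps i / (1 - eps i) <= 2 * eps i.
  rewrite ler_pdivrMr; last by lra.
  have := ler_wpM2l (ltW e_gt0) e_small; lra.
have e1_ge0 : 0 <= eps i / (1 - eps i) by rewrite divr_ge0//; lra.
rewrite [`|eps i|]gtr0_norm// (le_trans (ler_normD _ _))//.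
have qw_le : `|(eps i / (1 - eps i)) *: (S *m mxabs w)| <= 2 * eps i * (M * W).
  rewrite normrZ ger0_norm// ler_pM// (le_trans (mx_norm_mul _ _))// norm_mxabs ler_wpM2l//.
have qdx_le : `|gfun c A u v *m mxabs dx| <= G * (C * Q * eps i).
  by rewrite (le_trans (mx_norm_mul _ _))// norm_mxabs ler_wpM2l.
have {}t_le := le_trans t_le (ler_wpM2l (ltW k_gt0) xw_le).
have := lerD (le_trans (ler_normD _ _) (lerD t_le qdx_le)) qw_le.
move/le_trans; apply; lra.
Unshelve. all: by end_near. Qed.
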